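(* Let $p\in(0,1)$, $0<d<1<u$, $q=\frac{u-1}{u-d}$, $\epsilon>0$, $0\le\eta<\epsilon$, $b=p(1+\eta)$. For each $n\in\mathbb{N}$ put $e(n)=np(1+\epsilon)$ and consider the Combined Market with $n$ lives described in the context, in which the XoL contract has excess $e(n)$ and is priced by the reinsurer using the measure $\mathbb{P}^b$, so that its price at time $0$ is $$X_0^e(n;b)=\sum_{k>e(n)}(k-e(n))\,\mathbb{P}^b(D_1=k).$$ To avoid arbitrage, $X_0^e(n;b)$ is required to satisfy $\frac{X_0^e(n;b)}{n-e(n)}<p$. Let the loan amount satisfy $S_0d<L\le S_0u$ and $L-S_0d=1$. Assume that $\epsilon$ is sufficiently small so that $\max(p,q)<\frac{1}{1+\epsilon}$. Then, for all sufficiently large $n$, the minimal superhedge of the claim $D_1(L-S_1)^+$ consists of $e(n)$ property puts and one XoL contract with excess $e(n)$. The tracking error, i.e. the difference between the average cost $\frac1nV_0(n)$ of this superhedge (where $V_0(n)$ is its initial cost) and the average cost $pq$ of the asymptotic portfolio, is given by $$\frac1n V_0(n)-pq=\epsilon pq+\frac1n X_0^e(n;b).$$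
   Context: Sample space for $n$ lives: $\Omega=\{0,1\}^{n+1}$ with the power set; write $\omega=(\omega_0,\omega_1,\dots,\omega_n)$. $D_1(\omega)=\omega_1+\dots+\omega_n$ is the number of deaths. Combined Market (times $t=0,1$; all prices discounted; any long or short positions are allowed, no frictions). Assets: - cash, with constant price $1$; - a property stock with $S_0>0$, $S_1=S_0u$ if $\omega_0=1$ and $S_1=S_0d$ if $\omega_0=0$; - for $i=1,\dots,n$ a single-life assurance with price $p$ at time $0$ and payout $\omega_i$ at time $1$ (one of each forms a group life assurance costing $np$ and paying $D_1$); - an excess-of-loss (XoL) contract with excess $e(n)$ and payout $(D_1-e(n))^+$ at time $1$. $L>0$ is the loan amount. A property put is the payout $(L-S_1)^+$, synthesised from cash and stock; under the assumptions on $L$ it costs $q$. The ''asymptotic portfolio'' refers to the hypothetical hedge for infinitely many lives, which holds $p$ property puts per life at a cost of $pq$ per life. The reinsurer's pricing measure $\mathbb{P}^b$ is such that the lives are independent and Bernoulli-distributed with probability of death $b=p(1+\eta)$, so $D_1$ is binomial$(n,b)$ under $\mathbb{P}^b$. A portfolio is a vector of real holdings in these assets; $V_0$ is its price at time $0$ and $V_1$ its value at time $1$. It is a superhedge of a claim $C$ if $V_1\ge C$; it is minimal if no superhedge has a smaller initial cost.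
   Formalization: Minimality (with uniqueness) is claimed only for those large n for which e(n)=np(1+ε) is a whole number, since for fractional e(n) a cheaper superhedge exists for infinitely many n; the superhedge property and the tracking-error formula hold for all large n. *)

(* Defs.v *)
From HB Require Import structures.
From mathcomp Require Import all_boot all_order all_algebra.
From mathcomp Require Import reals.
From mathcomp Require Import ring lra.

Set Implicit Arguments.
Unset Strict Implicit.
Unset Printing Implicit Defensive.

Import Order.TTheory GRing.Theory Num.Theory.
Local Open Scope ring_scope.

Definition pos_part (R : realType) (x : R) : R := Num.max x 0.

Lemma ge0_pos_part (R : realType) (x : R) : 0 <= x -> pos_part x = x.
Proof. by move=> x0; rewrite /pos_part max_l. Qed.

Lemma le0_pos_part (R : realType) (x : R) : x <= 0 -> pos_part x = 0.
Proof. by move=> x0; rewrite /pos_part max_r. Qed.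

(* Coordinate 0 is the property price move ([true] = up); coordinate [i + 1]
   is the fate of the [i]-th life ([true] = death). *)
Definition outcome (n : nat) : Type := {ffun 'I_n.+1 -> bool}.

Definition property_up n (w : outcome n) : bool := w ord0.

Definition lives n (w : outcome n) : {ffun 'I_n -> bool} :=
  [ffun i => w (lift ord0 i)].

Definition deaths n (v : {ffun 'I_n -> bool}) : nat := (\sum_(i < n) v i)%N.

Definition D1 n (w : outcome n) : nat := deaths (lives w).

(* The reinsurer's measure on the fates of the lives (the price of the XoL
   contract does not involve the property coordinate). *)
Definition reinsurer_prob (R : realType) n (b : R) (v : {ffun 'I_n -> bool}) : R :=
  \prod_(i < n) (if v i then b else 1 - b).

Definition prob_deaths (R : realType) n (b : R) (k : nat) : R :=
  \sum_(v : {ffun 'I_n -> bool} | deaths v == k) reinsurer_prob b v.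

(* Only the values [k <= n] have positive probability. *)
Definition xol_premium (R : realType) n (e b : R) : R :=
  \sum_(k < n.+1 | e < k%:R) (k%:R - e) * prob_deaths n b k.

Record market (R : realType) := Market {
  stock_price : R;
  up_factor : R;
  down_factor : R;
  life_price : R;
  xol_excess : R;
  xol_price : R }.

Record portfolio (R : realType) (n : nat) := Portfolio {
  cash : R;
  stock : R;
  assurances : {ffun 'I_n -> R};
  xol : R }.

Section CombinedMarket.
Variables (R : realType) (n : nat) (M : market R).

Definition S1 (w : outcome n) : R :=
  stock_price M * (if property_up w then up_factor M else down_factor M).

Definition xol_payout (w : outcome n) : R :=
  pos_part ((D1 w)%:R - xol_excess M).

Definition V0 (h : portfolio R n) : R :=
  cash h + stock h * stock_price M
  + \sum_(i < n) assurances h i * life_price M + xol h * xol_price M.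

Definition V1 (h : portfolio R n) (w : outcome n) : R :=
  cash h + stock h * S1 w
  + \sum_(i < n) assurances h i * (lives w i)%:R + xol h * xol_payout w.

Definition superhedge (C : outcome n -> R) (h : portfolio R n) : Prop :=
  forall w, C w <= V1 h w.

Definition minimal_superhedge (C : outcome n -> R) (h : portfolio R n) : Prop :=
  superhedge C h /\ forall h', superhedge C h' -> V0 h <= V0 h'.

Definition put_payout (L : R) (w : outcome n) : R := pos_part (L - S1 w).

(* The one-period binomial replication of the put [(L - S_1)^+]. *)
Definition put_stock (L : R) : R :=
  (pos_part (L - stock_price M * up_factor M)
   - pos_part (L - stock_price M * down_factor M))
  / (stock_price M * (up_factor M - down_factor M)).

Definition put_cash (L : R) : R :=
  pos_part (L - stock_price M * down_factor M)
  - put_stock L * (stock_price M * down_factor M).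

Definition puts_and_xol (L a c : R) : portfolio R n :=
  Portfolio (a * put_cash L) (a * put_stock L) [ffun=> 0] c.

Definition death_put_claim (L : R) (w : outcome n) : R :=
  (D1 w)%:R * put_payout L w.

Lemma V1_puts_and_xol (L a c : R) (w : outcome n) :
  0 < stock_price M -> down_factor M < up_factor M ->
  V1 (puts_and_xol L a c) w = a * put_payout L w + c * xol_payout w.
Proof.
move=> S0 du; rewrite /V1 /= big1 ?addr0; last by move=> i _; rewrite ffunE mul0r.
congr (_ + _); rewrite /put_cash /put_stock /put_payout /S1.
case: (property_up w); field; rewrite ?gt_eqF ?subr_gt0//.
Qed.

Lemma V0_puts_and_xol (L a c : R) :
  0 < stock_price M -> down_factor M < up_factor M ->
  L <= stock_price M * up_factor M -> L - stock_price M * down_factor M = 1 ->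
  V0 (puts_and_xol L a c)
  = a * ((up_factor M - 1) / (up_factor M - down_factor M)) + c * xol_price M.
Proof.
move=> S0 du Lu Ld; rewrite /V0 /= big1 ?addr0; last by move=> i _; rewrite ffunE mul0r.
congr (_ + _); rewrite /put_cash /put_stock Ld.
rewrite (ge0_pos_part ler01) (le0_pos_part (x := L - _)) ?subr_le0//.
by field; rewrite ?gt_eqF ?subr_gt0.
Qed.

(* Minimality of the hedge with [e] puts and one XoL contract needs an excess [e]
   that is a whole number of deaths. If [m - 1 < e < m] and the XoL premium is
   below [q * (m - e)], then [m - 1] puts and [1 / (m - e)] XoL contracts
   superhedge the claim at a lower cost. The premium for [e = n p (1 + eps)]
   decreases exponentially in [n], so this happens for infinitely many [n]. *)
Lemma fractional_excess_not_minimal (L : R) (m : nat) :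
  0 < stock_price M -> down_factor M < up_factor M ->
  L <= stock_price M * up_factor M -> L - stock_price M * down_factor M = 1 ->
  m%:R - 1 < xol_excess M < m%:R ->
  xol_price M < (up_factor M - 1) / (up_factor M - down_factor M)
                * (m%:R - xol_excess M) ->
  ~ minimal_superhedge (death_put_claim L) (puts_and_xol L (xol_excess M) 1).
Proof.
move=> S0 du Lu Ld /andP[em me] Xq [_ minh].
set e := xol_excess M in em me Xq minh *.
have k0 : 0 < m%:R - e by rewrite subr_gt0.
have := minh (puts_and_xol L (m%:R - 1) (m%:R - e)^-1).
rewrite !V0_puts_and_xol//.
set q := (_ / _) in Xq *; set X := xol_price M in Xq *.
have lt : (m%:R - 1) * q + (m%:R - e)^-1 * X < e * q + 1 * X.
  rewrite -subr_gt0.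
  have -> : e * q + 1 * X - ((m%:R - 1) * q + (m%:R - e)^-1 * X)
    = (e - (m%:R - 1)) * (q * (m%:R - e) - X) / (m%:R - e).
    by field; rewrite gt_eqF.
  by rewrite divr_gt0// mulr_gt0// subr_gt0.
move=> H; suff : superhedge (death_put_claim L)
    (puts_and_xol L (m%:R - 1) (m%:R - e)^-1).
  by move=> /H; rewrite leNgt lt.
move=> w; rewrite V1_puts_and_xol// /death_put_claim.
have xol0 : 0 <= (m%:R - e)^-1 * xol_payout w.
  by rewrite mulr_ge0 ?invr_ge0 ?(ltW k0)// /xol_payout /pos_part le_max lexx orbT.
rewrite /put_payout /S1; case: (property_up w).
  by rewrite le0_pos_part ?subr_le0// !mulr0 add0r.
rewrite Ld (ge0_pos_part ler01) !mulr1.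
have [Dm|mD] := ltnP (D1 w) m.
  have : ((D1 w).+1)%:R <= m%:R :> R by rewrite ler_nat.
  rewrite -natr1; lra.
have mD' : m%:R <= (D1 w)%:R :> R by rewrite ler_nat.
rewrite /xol_payout -/e ge0_pos_part; last by lra.
rewrite -subr_ge0.
have -> : m%:R - 1 + (m%:R - e)^-1 * ((D1 w)%:R - e) - (D1 w)%:R
  = ((D1 w)%:R - m%:R) * (e - (m%:R - 1)) / (m%:R - e).
  by field; rewrite gt_eqF.
by rewrite divr_ge0 ?mulr_ge0//; lra.
Qed.

End CombinedMarket.

(* Main.v *)
(* Linear programming duality. Let m = e(n) be a whole number. There is a pricing
   measure, exchangeable in the lives, which prices every asset correctly and
   charges only outcomes where the hedge is exact: property down with m or n
   deaths, property up with 0 or m deaths. Hence no superhedge is cheaper, and a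
   superhedge of the same cost must also be exact on these outcomes, which
   determines all its holdings. The four masses are positive as soon as the XoL
   premium X satisfies 0 < X < q (n - m) and X < n p - m q. This holds for large n,
   because X is bounded in n: (D - e)^+ <= (D - n b)^2 / (4 (e - n b)), and the
   variance of D and e - n b are both linear in n. *)
Require Import Defs.
From mathcomp Require Import all_boot all_order all_algebra.
From mathcomp Require Import perm reals.
From mathcomp Require Import ring lra.
Import Order.TTheory GRing.Theory Num.Theory.
Local Open Scope ring_scope.

(** * Variance of the number of deaths and bounds on the XoL premium *)

(** Independence of the lives: distributivity turns the expectation of a product into a product of
    expectations. *)
Lemma sum_reinsurer_prob (R : realType) n (b : R) (f : 'I_n -> bool -> R) :
  \sum_(v : {ffun 'I_n -> bool}) reinsurer_prob b v * \prod_k f k (v k)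
  = \prod_k (b * f k true + (1 - b) * f k false).
Proof.
transitivity (\sum_(v : {ffun 'I_n -> bool})
    \prod_k ((if v k then b else 1 - b) * f k (v k))).
  by apply: eq_bigr => v _; rewrite [RHS]big_split.
rewrite -(bigA_distr_bigA (fun k x => (if x then b else 1 - b) * f k x)).
by apply: eq_bigr => k _; rewrite big_bool.
Qed.

(** The square expands into covariances; those of distinct lives vanish by independence. *)
Lemma deaths_variance (R : realType) n (b : R) :
  \sum_(v : {ffun 'I_n -> bool})
     reinsurer_prob b v * ((deaths v)%:R - n%:R * b) ^+ 2
  = n%:R * (b * (1 - b)).
Proof.
have dev (v : {ffun 'I_n -> bool}) :
    (deaths v)%:R - n%:R * b = \sum_(i < n) ((v i)%:R - b).
  by rewrite sumrB /deaths natr_sum sumr_const card_ord mulr_natl.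
have cov (i j : 'I_n) : \sum_(v : {ffun 'I_n -> bool})
    reinsurer_prob b v * (((v i)%:R - b) * ((v j)%:R - b))
    = if i == j then b * (1 - b) else 0.
  pose f k (x : bool) : R :=
    (if k == i then x%:R - b else 1) * (if k == j then x%:R - b else 1).
  (* A single factor is padded with ones to a product over all lives, the form that
     [sum_reinsurer_prob] needs. *)
  have pick (k0 : 'I_n) (x : R) (F : 'I_n -> R) : F k0 = x ->
      \prod_(k < n) (if k == k0 then F k else 1) = x.
    by move=> <-; rewrite -big_mkcond big_pred1_eq.
  under eq_bigr => v _.
    rewrite -(pick i _ (fun k => (v k)%:R - b) (erefl _)).
    rewrite -(pick j _ (fun k => (v k)%:R - b) (erefl _)).
    rewrite -big_split /=.
    over.
  rewrite (sum_reinsurer_prob _ _ _ f) /f.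
  have [<-|ij] := eqVneq i j.
    rewrite (bigD1 i) //= big1 ?mulr1 ?eqxx; first by ring.
    by move=> k /negPf->; ring.
  by rewrite (bigD1 i) //= eqxx (negPf ij); ring.
under eq_bigr => v _ do rewrite dev expr2 big_distrlr mulr_sumr.
rewrite exchange_big /=.
under eq_bigr => i _.
  under eq_bigr => v _ do rewrite mulr_sumr.
  rewrite exchange_big /=.
  under eq_bigr => j _ do rewrite cov.
  rewrite -big_mkcond (eq_bigl (pred1 i)) ?big_pred1_eq; last first.
    by move=> j; rewrite /= eq_sym.
  over.
by rewrite sumr_const card_ord mulr_natl.
Qed.

Lemma reinsurer_prob_ge0 (R : realType) n (b : R) (v : {ffun 'I_n -> bool}) :
  0 <= b <= 1 -> 0 <= reinsurer_prob b v.
Proof.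
by move=> /andP[b0 b1]; apply: prodr_ge0 => i _; case: (v i); rewrite ?subr_ge0.
Qed.

Lemma deaths_le n (v : {ffun 'I_n -> bool}) : (deaths v <= n)%N.
Proof.
rewrite -[X in (_ <= X)%N]card_ord -sum1_card.
by apply: leq_sum => i _; exact: leq_b1.
Qed.

Lemma prob_deaths_ge0 (R : realType) n (b : R) k :
  0 <= b <= 1 -> 0 <= prob_deaths n b k.
Proof. by move=> hb; apply: sumr_ge0 => v _; exact: reinsurer_prob_ge0. Qed.

(** The list in which every life dies has positive mass and exceeds the excess. *)
Lemma xol_premium_gt0 (R : realType) n (e b : R) :
  0 < b <= 1 -> e < n%:R -> 0 < xol_premium n e b.
Proof.
move=> /andP[b0 b1] en; have hb : 0 <= b <= 1 by rewrite ltW.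
rewrite /xol_premium (bigD1 (@ord_max n)) //=; apply: ltr_pwDl; last first.
  apply: sumr_ge0 => k /andP[ek _].
  by rewrite mulr_ge0 ?prob_deaths_ge0// subr_ge0 ltW.
rewrite mulr_gt0 ?subr_gt0// /prob_deaths.
rewrite (bigD1 [ffun=> true]) /=; last first.
  rewrite /deaths; under eq_bigr do rewrite ffunE.
  by rewrite sum_nat_const card_ord muln1.
apply: ltr_pwDl; last by apply: sumr_ge0 => v _; exact: reinsurer_prob_ge0.
by apply: prodr_gt0 => i _; rewrite ffunE.
Qed.

Lemma xol_premium_le (R : realType) n (e b : R) :
  0 <= b <= 1 -> n%:R * b < e ->
  xol_premium n e b <= n%:R * (b * (1 - b)) / (4 * (e - n%:R * b)).
Proof.
move=> hb be; have a0 : 0 < 4 * (e - n%:R * b) by rewrite mulr_gt0// subr_gt0.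
rewrite ler_pdivlMr// -deaths_variance.
(* The variance is split by the number of deaths and compared with the premium term by term; below
   the excess its terms need only be nonnegative. *)
rewrite (partition_big (fun v => inord (deaths v) : 'I_n.+1) xpredT) //=.
rewrite /xol_premium mulr_suml big_mkcond; apply: ler_sum => k _.
have ev (v : {ffun 'I_n -> bool}) :
    (inord (deaths v) == k :> 'I_n.+1) = (deaths v == k :> nat).
  by rewrite -val_eqE /= inordK// ltnS deaths_le.
case: ifPn => ek; last first.
  apply: sumr_ge0 => v _; by rewrite mulr_ge0 ?sqr_ge0// reinsurer_prob_ge0.
rewrite (eq_bigl _ _ ev) mulrAC [leLHS]mulrC /prob_deaths mulr_suml.
apply: ler_sum => v /eqP ->.
(* AM-GM: [4 a x <= (x + a)^2] *)
apply: ler_wpM2l; first exact: reinsurer_prob_ge0.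
rewrite -subr_ge0.
set x := (k : nat)%:R : R; set c := n%:R * b.
have -> : (x - c) ^+ 2 - (x - e) * (4 * (e - c)) = (x - 2 * e + c) ^+ 2 by ring.
exact: sqr_ge0.
Qed.

(** * Exchangeability of the lives *)

Lemma exists_deaths n m : (m <= n)%N -> deaths [ffun i : 'I_n => (i < m)%N] = m.
Proof.
move=> mn; rewrite /deaths; under eq_bigr do rewrite ffunE.
transitivity (\sum_(i < n | (i < m)%N) 1)%N.
  by rewrite [RHS]big_mkcond; apply: eq_bigr => i _; case: ifP.
by rewrite -(big_ord_widen _ (fun=> 1%N) mn) sum_nat_const card_ord muln1.
Qed.

Definition swap_lives {n} (i j : 'I_n) (v : {ffun 'I_n -> bool}) :
  {ffun 'I_n -> bool} := [ffun k => v (tperm i j k)].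

Lemma swap_livesK n (i j : 'I_n) : involutive (swap_lives i j).
Proof. by move=> v; apply/ffunP => k; rewrite !ffunE tpermK. Qed.

Lemma deaths_swap n (i j : 'I_n) v : deaths (swap_lives i j v) = deaths v.
Proof.
rewrite /deaths [RHS](reindex_inj (@perm_inj _ (tperm i j))).
by apply: eq_bigr => k _; rewrite ffunE.
Qed.

(** By symmetry each life dies in the same number [T i] of lists; summing over the lives counts
    every list [m] times. *)
Lemma deaths_average (R : realType) n m (a : 'I_n -> R) :
  n%:R * \sum_(v : {ffun 'I_n -> bool} | deaths v == m) \sum_i a i * (v i)%:R
  = #|[pred v : {ffun 'I_n -> bool} | deaths v == m]|%:R * m%:R * \sum_i a i.
Proof.
pose T i : R := \sum_(v : {ffun 'I_n -> bool} | deaths v == m) (v i)%:R.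
have Tij i j : T i = T j.
  rewrite /T (reindex_inj (inv_inj (@swap_livesK n i j))) /=.
  by apply: eq_big => v; rewrite ?deaths_swap// ffunE tpermL.
have Ti i : n%:R * T i =
    #|[pred v : {ffun 'I_n -> bool} | deaths v == m]|%:R * m%:R.
  transitivity (\sum_j T j).
    by rewrite (eq_bigr _ (fun j _ => Tij j i)) sumr_const card_ord mulr_natl.
  rewrite exchange_big /=.
  under eq_bigr => v /eqP vm do rewrite -natr_sum -/(deaths v) vm.
  by rewrite sumr_const mulr_natl.
rewrite exchange_big /= !mulr_sumr; apply: eq_bigr => i _.
by rewrite -mulr_sumr -/(T i) mulrCA Ti mulrC.
Qed.

(* Exchangeability: the bound is averaged over all lists of [m] deaths. *)
Lemma exchangeable_bound (R : realType) n m (a : 'I_n -> R) (c : R) :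
  (0 < n)%N -> (m <= n)%N ->
  (forall v, deaths v = m -> 0 <= c + \sum_i a i * (v i)%:R) ->
  0 <= c + m%:R / n%:R * \sum_i a i /\
  (c + m%:R / n%:R * \sum_i a i = 0 ->
   forall v, deaths v = m -> c + \sum_i a i * (v i)%:R = 0).
Proof.
move=> n0 mn H; set W := #|[pred v : {ffun 'I_n -> bool} | deaths v == m]|.
have W0 : (0 < W)%N.
  by apply/card_gt0P; exists [ffun i : 'I_n => (i < m)%N]; rewrite inE exists_deaths.
have n0' : n%:R != 0 :> R by rewrite pnatr_eq0 -lt0n.
have E : \sum_(v : {ffun 'I_n -> bool} | deaths v == m)
    (c + \sum_i a i * (v i)%:R) = W%:R * (c + m%:R / n%:R * \sum_i a i).
  rewrite big_split /= sumr_const -/W mulrDr mulr_natl; congr (_ + _).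
  by apply: (mulfI n0'); rewrite deaths_average -/W; field.
have nn (v : {ffun 'I_n -> bool}) : deaths v == m ->
  0 <= c + \sum_i a i * (v i)%:R by move=> /eqP; exact: H.
split; first by rewrite -(pmulr_rge0 _ (_ : 0 < W%:R)) ?ltr0n// -E sumr_ge0.
move=> t0 v vm; move: E; rewrite t0 mulr0 => /(psumr_eq0P nn) -> //.
exact/eqP.
Qed.

(** Swapping a dead life with a survivor shows that their coefficients agree. As [0 < m < n], all
    coefficients agree, and [m] times their common value is 0. *)
Lemma exchangeable_eq0 (R : realType) n m (a : 'I_n -> R) :
  (0 < m < n)%N ->
  (forall v, deaths v = m -> \sum_i a i * (v i)%:R = 0) ->
  forall i, a i = 0.
Proof.
move=> /andP[m0 mn] H.
have [v vm vE] : exists2 v : {ffun 'I_n -> bool},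
    deaths v = m & forall i, v i = (i < m)%N.
  exists [ffun i : 'I_n => (i < m)%N]; first by rewrite exists_deaths// ltnW.
  by move=> i; rewrite ffunE.
have aij (i j : 'I_n) : v i -> ~~ v j -> a i = a j.
  move=> vi vj; have ji : j != i by apply: contraNneq vj => ->.
  have := H (swap_lives i j v); rewrite deaths_swap => /(_ vm).
  rewrite -{2}(H v vm) (bigD1 i) //= (bigD1 j) //=.
  rewrite [in RHS](bigD1 i) //= [in RHS](bigD1 j) //=.
  rewrite /swap_lives !(ffunE _ i) !(ffunE _ j) tpermL tpermR vi (negPf vj).
  under eq_bigr => k /andP[ki kj] do rewrite ffunE tpermD 1?eq_sym//.
  by rewrite !mulr0 !mulr1 !add0r => /addIr.
(* In [v], life [0] is dead and life [m] survives; each coefficient is linked to that of life [m],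
   directly or through life [0]. *)
have s_lt : (0 < n)%N by exact: leq_ltn_trans mn.
have at_ i : a i = a (Ordinal mn).
  have vs : v (Ordinal s_lt) by rewrite vE.
  have vt : ~~ v (Ordinal mn) by rewrite vE ltnn.
  have [vi|vi] := boolP (v i); first exact: aij.
  by rewrite -(aij _ _ vs vi); exact: aij.
move=> i; have := H v vm.
under eq_bigr do rewrite at_.
rewrite -mulr_sumr -natr_sum -/(deaths v) vm => /eqP.
by rewrite mulf_eq0 pnatr_eq0 (gtn_eqF m0) orbF -(at_ i) => /eqP.
Qed.

(** * Superhedging and the dual bound for a whole excess *)

Definition outcome_of {n} (up : bool) (v : {ffun 'I_n -> bool}) : outcome n :=
  [ffun i => if unlift ord0 i is Some j then v j else up].

Lemma property_up_outcome_of n up (v : {ffun 'I_n -> bool}) :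
  property_up (outcome_of up v) = up.
Proof. by rewrite /property_up ffunE unlift_none. Qed.

Lemma lives_outcome_of n up (v : {ffun 'I_n -> bool}) :
  lives (outcome_of up v) = v.
Proof. by apply/ffunP => i; rewrite !ffunE liftK. Qed.

(** When the property falls, this is [D1 <= e + (D1 - e)^+], valid for any real excess. *)
Lemma superhedge_puts_and_xol (R : realType) n (M : market R) (L : R) :
  0 < stock_price M -> down_factor M < up_factor M ->
  L <= stock_price M * up_factor M -> L - stock_price M * down_factor M = 1 ->
  superhedge M (@death_put_claim R n M L) (puts_and_xol n M L (xol_excess M) 1).
Proof.
move=> S0 du Lu Ld w; rewrite V1_puts_and_xol// /death_put_claim mul1r.
have xge0 : 0 <= xol_payout M w by rewrite /xol_payout /pos_part le_max lexx orbT.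
have xge : (D1 w)%:R - xol_excess M <= xol_payout M w.
  by rewrite /xol_payout /pos_part le_max lexx.
rewrite /put_payout /S1; case: (property_up w).
  by rewrite le0_pos_part ?subr_le0// !mulr0 add0r.
by rewrite Ld (ge0_pos_part ler01) !mulr1 -lerBlDl.
Qed.

(** Isolates the part of the surplus that is linear in the individual lives, as [exchangeable_bound]
    requires. *)
Lemma gain_outcome_of (R : realType) n (M : market R) (L : R)
    (h : portfolio R n) up v :
  L <= stock_price M * up_factor M -> L - stock_price M * down_factor M = 1 ->
  V1 M h (outcome_of up v) - death_put_claim M L (outcome_of up v) =
  cash h
  + stock h * (stock_price M * (if up then up_factor M else down_factor M))
  + xol h * pos_part ((deaths v)%:R - xol_excess M)
  - (if up then 0 else (deaths v)%:R)
  + \sum_i assurances h i * (v i)%:R.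
Proof.
move=> Lu Ld; rewrite /V1 /death_put_claim /put_payout /xol_payout /S1 /D1.
rewrite property_up_outcome_of lives_outcome_of /=; case: up.
  by rewrite (le0_pos_part (x := L - _)) ?subr_le0//; ring.
by rewrite Ld (ge0_pos_part ler01); ring.
Qed.

(** The bounds on [X] and on [n%:R * p] are what makes the four masses of the pricing measure
    positive. *)
Lemma whole_excess_optimal (R : realType) (n m : nat) (S0 u d p X L : R)
    (h' : portfolio R n) :
  0 < S0 -> d < 1 -> 1 < u -> L <= S0 * u -> L - S0 * d = 1 ->
  (0 < m < n)%N ->
  let q := (u - 1) / (u - d) in
  let M := Market S0 u d p m%:R X in
  let h := puts_and_xol n M L m%:R 1 in
  0 < X -> X < q * (n%:R - m%:R) ->
  m%:R * q + X < n%:R * p -> n%:R * p < m%:R ->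
  superhedge M (death_put_claim M L) h' ->
  V0 M h <= V0 M h' /\ (V0 M h' = V0 M h -> h' = h).
Proof.
move=> hS0 hd hu hLu hLd hmn q M h hX0 hXq hmq hpm sh; have /andP[m0 mn] := hmn; have n0 : (0 < n)%N by exact: leq_trans mn.
have du : 0 < u - d by lra.
have m0R : 0 < m%:R :> R by rewrite ltr0n.
have n0R : 0 < n%:R :> R by rewrite ltr0n.
have mnR : 0 < n%:R - m%:R :> R by rewrite subr_gt0 ltr_nat.
pose A := \sum_i assurances h' i.
have bound up k : (k <= n)%N ->
    let c := cash h' + stock h' * (S0 * (if up then u else d))
      + xol h' * pos_part (k%:R - m%:R) - (if up then 0 else k%:R) in
    0 <= c + k%:R / n%:R * A /\
    (c + k%:R / n%:R * A = 0 ->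
     forall v, deaths v = k -> c + \sum_i assurances h' i * (v i)%:R = 0).
  move=> kn c; apply: exchangeable_bound => // v vk.
  by have := sh (outcome_of up v); rewrite -subr_ge0 gain_outcome_of// vk.
have := bound false m (ltnW mn); have := bound false n (leqnn n).
have := bound true 0%N isT; have := bound true m (ltnW mn).
rewrite subrr (ge0_pos_part (lexx 0)) (ge0_pos_part (ltW mnR)).
rewrite le0_pos_part ?subr_le0 ?ler0n//= !mulr0 !addr0 !subr0.
set g4 := _ + m%:R / _ * A; move=> [g4_ge0 g4_eq].
set g3 := _ + 0 / _ * A; move=> [g3_ge0 _].
set g2 := _ + n%:R / _ * A; move=> [g2_ge0 _].
set g1 := _ + m%:R / _ * A; move=> [g1_ge0 _].
(* [w1] and [w2] are the masses of down with [m] and [n] deaths, [w3] and [w4]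
   those of up with [0] and [m] deaths; pricing the four assets determines them. *)
pose w2 := X / (n%:R - m%:R); pose w1 := q - w2.
pose w4 := (n%:R * p - m%:R * q - X) / m%:R; pose w3 := 1 - q - w4.
have w2_gt0 : 0 < w2 by rewrite divr_gt0.
have w1_gt0 : 0 < w1 by rewrite subr_gt0 ltr_pdivrMr.
have w4_gt0 : 0 < w4 by rewrite divr_gt0//; lra.
have w3_gt0 : 0 < w3 by rewrite subr_gt0 ltr_pdivrMr//; lra.
have V0h : V0 M h = m%:R * q + X by rewrite V0_puts_and_xol ?mul1r//=; lra.
(* The extra cost is the expectation of the averaged surpluses under the pricing measure, in which
   [q] is the total mass of the down outcomes. *)
have V0h' : V0 M h' - V0 M h = (w1 * g1 + w2 * g2) + (w3 * g3 + w4 * g4).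
  rewrite V0h /V0 -mulr_suml -/A /= /w3 /w1 /w2 /w4 /g1 /g2 /g3 /g4 /q.
  by field; rewrite !gt_eqF.
have s1 := mulr_ge0 (ltW w1_gt0) g1_ge0; have s2 := mulr_ge0 (ltW w2_gt0) g2_ge0.
have s3 := mulr_ge0 (ltW w3_gt0) g3_ge0; have s4 := mulr_ge0 (ltW w4_gt0) g4_ge0.
split; first by rewrite -subr_ge0 V0h' !addr_ge0.
move=> eqV; move: V0h'; rewrite eqV subrr => /esym /eqP.
rewrite !paddr_eq0 ?addr_ge0//.
rewrite (mulf_eq0 w1) (mulf_eq0 w2) (mulf_eq0 w3) (mulf_eq0 w4).
rewrite (gt_eqF w1_gt0) (gt_eqF w2_gt0) (gt_eqF w3_gt0) (gt_eqF w4_gt0) /=.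
move=> /andP[/andP[/eqP g10 /eqP g20] /andP[/eqP g30 /eqP g40]].
(* [g3 = 0] kills the constant part of the surplus in the up state, so [g4 = 0] leaves a linear form
   that vanishes on all lists of [m] deaths. *)
have a0 : forall i, assurances h' i = 0.
  apply: (exchangeable_eq0 _ _ _ _ hmn) => v vm.
  by have := g4_eq g40 v vm; move: g30; rewrite /g3 !mul0r addr0 => ->; rewrite add0r.
have A0 : A = 0 by exact: big1.
(* Three linear equations remain: [g1] and [g2] give the XoL holding, [g1] and [g3] give stock and
   cash. *)
move: g10 g20 g30; rewrite /g1 /g2 /g3 A0 !mulr0 !addr0.
case: h' a0 {bound sh A g1 g2 g3 g4 g4_eq g1_ge0 g2_ge0 g3_ge0 g4_ge0 s1 s2 s3 s4 g40 eqV A0}.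
move=> c s a x /= a0 g1 g2 g3.
have a_0 : a = [ffun=> 0] by apply/ffunP => i; rewrite a0 ffunE.
have x1 : x = 1.
  by apply: (mulIf (lt0r_neq0 mnR)); lra.
have Sne : S0 * (u - d) != 0 by rewrite mulf_neq0 ?gt_eqF.
have sE : s = m%:R * put_stock M L.
  rewrite /put_stock /= hLd (ge0_pos_part ler01) le0_pos_part ?subr_le0//.
  by apply: (mulIf Sne); rewrite mulrA mulfVK//; lra.
rewrite /h /puts_and_xol a_0 x1 -sE; congr Portfolio.
rewrite /put_cash /= hLd (ge0_pos_part ler01) mulrBr [m%:R * (_ * _)]mulrA -sE; lra.
Qed.

(** * The hedge for large [n] *)

(** Minimality is claimed for whole [e] only, in view of [fractional_excess_not_minimal]; there it
    comes with uniqueness of the holdings. *)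
Theorem proposition6p4 (R : realType) (p d u eps eta S0 L : R)
    (hp : 0 < p < 1) (hd : 0 < d < 1) (hu : 1 < u)
    (heps : 0 < eps) (heta : 0 <= eta < eps)
    (hS0 : 0 < S0) (hL : S0 * d < L <= S0 * u) (hLd : L - S0 * d = 1)
    (hmax : Num.max p ((u - 1) / (u - d)) < 1 / (1 + eps)) :
  exists N : nat, forall n : nat, (N <= n)%N ->
    let q := (u - 1) / (u - d) in
    let b := p * (1 + eta) in
    let e := n%:R * p * (1 + eps) in
    let X := xol_premium n e b in
    let M := Market S0 u d p e X in
    let C := @death_put_claim R n M L in
    let h := puts_and_xol n M L e 1 in
    X / (n%:R - e) < p ->
    [/\ superhedge M C h,
        (e \is a Num.nat ->
           minimal_superhedge M C h /\
           forall h', minimal_superhedge M C h' -> h' = h)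
      & n%:R^-1 * V0 M h - p * q = eps * p * q + n%:R^-1 * X].
Proof.
have /andP[p0 p1] := hp; have /andP[d0 d1] := hd; have /andP[eta0 etaeps] := heta.
have /andP[_ Lu] := hL; have eps1 : 0 < 1 + eps by lra.
have du : d < u by lra.
move: hmax; rewrite gt_max !ltr_pdivlMr//.
set q := (u - 1) / (u - d) => /andP[peps qeps].
have q0 : 0 < q by rewrite divr_gt0 ?subr_gt0.
set b := p * (1 + eta).
have b0 : 0 < b by rewrite mulr_gt0//; lra.
have bp : b < p * (1 + eps) by rewrite ltr_pM2l//; lra.
have b1 : b < 1 by lra.
have gap : 0 < 4 * (p * (1 + eps) - b) by lra.
(* By Chebyshev's inequality the premium is bounded by [K], uniformly in [n]. *)
pose K := b * (1 - b) / (4 * (p * (1 + eps) - b)).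
have r1 : 0 < q * (1 - p * (1 + eps)) by rewrite mulr_gt0//; lra.
have r2 : 0 < p * (1 - q * (1 + eps)) by rewrite mulr_gt0//; lra.
(* For [n] above [B], [K] is below both [q * (n - e)] and [n * p - e * q], the two upper bounds
   required of [X]; [hmax] makes the denominators positive. *)
pose B := Num.max (K / (q * (1 - p * (1 + eps)))) (K / (p * (1 - q * (1 + eps)))).
have K0 : 0 <= K by rewrite divr_ge0 ?mulr_ge0 ?ltW//; lra.
have B0 : 0 <= B by rewrite /B le_max (divr_ge0 K0 (ltW r1)).
(* The successor ensures [0 < n]. *)
exists (Num.bound B).+1 => n Nn /=; set e := n%:R * p * (1 + eps).
set X := xol_premium n e b => _.
have n0 : 0 < n%:R :> R by rewrite ltr0n (leq_trans _ Nn).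
have Bn : B < n%:R.
  by apply: lt_le_trans (archi_boundP B0) _; rewrite ler_nat ltnW.
move: Bn; rewrite /B gt_max (ltr_pdivrMr _ _ r1) (ltr_pdivrMr _ _ r2) => /andP[K1 K2].
have en : e < n%:R by rewrite /e -mulrA gtr_pMr.
have X0 : 0 < X by apply: xol_premium_gt0 => //; rewrite b0 ltW.
have XK : X <= K.
  (* The factor [n] cancels between the variance and the gap [e - n%:R * b]. *)
  have -> : K = n%:R * (b * (1 - b)) / (4 * (e - n%:R * b)).
    rewrite /K /e; field; rewrite !gt_eqF//=; nra.
  apply: xol_premium_le; first by rewrite !ltW.
  by rewrite /e -mulrA ltr_pM2l.
have sh := @superhedge_puts_and_xol R n (Market S0 u d p e X) L hS0 du Lu hLd.
split => //; last first.
  rewrite V0_puts_and_xol//= -/q /e; field; exact: lt0r_neq0.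
move=> /natrP[m em]; rewrite em in sh *.
have mn : (0 < m < n)%N by rewrite -!(ltr_nat R) -em en andbT !mulr_gt0.
have opt h' := @whole_excess_optimal R n m S0 u d p X L h' hS0 d1 hu Lu hLd mn X0.
have Xq : X < (u - 1) / (u - d) * (n%:R - m%:R).
  by have := le_lt_trans XK K1; rewrite -/q -em /e; lra.
have mq : m%:R * ((u - 1) / (u - d)) + X < n%:R * p.
  by have := le_lt_trans XK K2; rewrite -/q -em /e; lra.
have pm : n%:R * p < m%:R by rewrite -em /e ltr_pMr ?mulr_gt0//; lra.
split; first by split => // h' /(opt _ Xq mq pm)[].
move=> h' [sh' min']; have [le eq] := opt h' Xq mq pm sh'.
by apply: eq; apply: le_anti; rewrite le min'.
Qed.
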